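(* Every signed graph $G$ with maximum average degree $\mathrm{mad}(G) < \frac{17}{5}$ admits a homomorphism to the signed graph $SP_9^+$. That is, $\chi_s(\mathcal{M}_{\frac{17}{5}}) \le 10$.
   Context: A signed graph $G=(V,E,s)$ is a finite simple graph $(V,E)$ (no loops, no parallel edges) together with a signature $s:E\to\{-1,+1\}$; edges with sign $+1$ are positive, with sign $-1$ negative. Switching a vertex $v$ reverses the sign of every edge incident to $v$; two signed graphs are switching equivalent if one can be obtained from the other by a sequence of switches. For signed graphs $G$ and $H$, a map $\varphi:V(G)\to V(H)$ is a homomorphism if there is a signed graph $G'$ switching equivalent to $G$ such that for every edge $uv$ of $G'$, $\varphi(u)\varphi(v)$ is an edge of $H$ with the same sign as $uv$ in $G'$. The chromatic number $\chi_s(G)$ is the minimum order of a signed graph $H$ such that $G$ admits a homomorphism to $H$; for a class $\mathcal{C}$ of signed graphs, $\chi_s(\mathcal{C})$ is the maximum of $\chi_s(G)$ over $G\in\mathcal{C}$. The maximum average degree $\mathrm{mad}(G)$ is the maximum of $2|E(H)|/|V(H)|$ over all (nonempty) subgraphs $H$ of the underlying graph; $\mathcal{M}_k$ denotes the class of signed graphs with $\mathrm{mad} < k$. For a prime power $q\equiv 1 \pmod 4$, the signed Paley graph $SP_q$ has vertex set the finite field $\mathbb{F}_q$, and any two distinct vertices $u,v$ are joined by a positive edge if $u-v$ is a square in $\mathbb{F}_q$ and by a negative edge otherwise. For a signed graph $H$, $H^+$ denotes the signed graph obtained from $H$ by adding one new vertex joined by a positive edge to every vertex of $H$. Thus $SP_9^+$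 is a complete signed graph on $10$ vertices. *)

(* Defs.v *)
From mathcomp Require Import all_boot all_order all_algebra.
Set Implicit Arguments. Unset Strict Implicit. Unset Printing Implicit Defensive.
Import GRing.Theory Num.Theory.

(* x^2 + 1 is irreducible over F_3, so F_3[X]/(X^2+1) is the field with 9
   elements.  An element (a, b) stands for a + b i. *)
Definition F9 : finType := ('F_3 * 'F_3)%type.

Definition subF9 (u v : F9) : F9 := ((u.1 - v.1)%R, (u.2 - v.2)%R).
Definition mulF9 (u v : F9) : F9 :=
  ((u.1 * v.1 - u.2 * v.2)%R, (u.1 * v.2 + u.2 * v.1)%R).
Definition sqF9 (x : F9) : bool := [exists w : F9, mulF9 w w == x].

(* Vertices: Some a for a in F_9 (the signed Paley graph SP_9),
   None for the extra vertex joined positively to all of SP_9.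
   Complete graph on 10 vertices.  Sign: true = positive. *)
Definition SP9p_adj (x y : option F9) : bool := x != y.
Definition SP9p_sign (x y : option F9) : bool :=
  match x, y with
  | Some u, Some v => sqF9 (subF9 u v)
  | _, _ => true
  end.

(* A signed graph on a finite vertex type V is given by a symmetric
   irreflexive adjacency relation adj and a signature sg : V -> V -> bool
   (true = positive edge), symmetric on edges. *)

Definition switch (V : eqType) (v : V) (sg : V -> V -> bool) : V -> V -> bool :=
  fun x y => ((x == v) (+) (y == v)) (+) sg x y.

Definition switch_seq (V : eqType) (s : seq V) (sg : V -> V -> bool) :
  V -> V -> bool := foldr (@switch V) sg s.

Definition signed_hom (V W : eqType) (adj : rel V) (sg : V -> V -> bool)
  (adjH : rel W) (sgH : W -> W -> bool) (phi : V -> W) : Prop :=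
  exists s : seq V, forall x y, adj x y ->
    adjH (phi x) (phi y) /\ sgH (phi x) (phi y) = switch_seq s sg x y.

Definition edges (V : finType) (adj : rel V) : {set {set V}} :=
  [set [set x; y] | x in V, y in V & adj x y].

Definition mad_lt (V : finType) (adj : rel V) (k : rat) : Prop :=
  forall (S : {set V}) (F : {set {set V}}),
    S != set0 -> F \subset edges adj -> (forall e, e \in F -> e \subset S) ->
    ((2 * #|F|)%:R / #|S|%:R < k)%R.

(* Main.v *)
(* A homomorphism to SP_9^+ after switching is a colouring by the 20 vertices of
   its antitwinned double cover, with the sign of every edge respected.  Any two
   non-antipodal colours have at least 4 common neighbours there, any three
   pairwise non-antipodal colours at least one.

   In a graph without such a colouring that is minimal in the number of edges,
   vertices of degree at most 3 ("light") are pairwise non-adjacent, and a light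
   vertex can be coloured last as soon as its neighbours, as seen from it, are
   pairwise non-antipodal.  Hence a light neighbour of degree d of a heavy vertex
   x forbids at most d - 1 colours at x.  Let s be the number of heavy neighbours
   of x and w the sum of these d - 1.  Uncolouring x shows that w >= 20, 9, 4
   when s = 0, 1, 2.  Uncolouring two or three heavy vertices excludes an edge
   between (s = 2, w <= 5) and (s = 2, w <= 5) or (s = 3, w <= 1), and the paths
   (3, <= 1)-(3, <= 1)-(3, <= 1) and (3, <= 2)-(2, <= 4)-(3, <= 2).

   Give x the charge 30 deg x - 102 = 30 (deg x - 17/5).  Vertices of degree 2
   and 3 receive 21 and 4 from each neighbour.  Heavy vertices then lack charge
   only if (s, w) = (3, 1), lacking 3, or (2, 4) with light neighbours of degree
   2 only, lacking 6; their heavy neighbours supply it.  So the average degree is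
   at least 17/5. *)
Require Import Defs.
From mathcomp Require Import all_boot all_order all_algebra.
From mathcomp Require Import zify.

Set Implicit Arguments. Unset Strict Implicit. Unset Printing Implicit Defensive.

(* Abstracting the cardinals first spares lia costly conversion tests. *)
Ltac card_lia := repeat match goal with
  | |- context [#|?A|] => let n := fresh "n" in move: #|A| => n
  end; clear; lia.

Lemma set3P (T : finType) (x a b c : T) :
  reflect [\/ x = a, x = b | x = c] (x \in [set a; b; c]).
Proof. by rewrite !inE -orbA; apply: (iffP or3P) => -[] /eqP; constructor. Qed.

Lemma subset_meet (T : finType) (A B C : {set T}) :
  A \subset C -> B \subset C -> #|C| < #|A| + #|B| -> exists x, x \in A :&: B.
Proof.
move=> AC BC H; apply/set0Pn; rewrite -card_gt0.
have := subset_leq_card (introT subUsetP (conj AC BC)).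
by have := cardsUI A B; move: H; card_lia.
Qed.

Lemma leq_card_setD1 (T : finType) (A : {set T}) z : #|A| <= #|A :\ z|.+1.
Proof. by rewrite (cardsD1 z A) -addn1 addnC leq_add2l; case: (z \in A). Qed.

(** * The antitwinned double cover of [SP_9^+] *)

(* (e, p) is the vertex p of SP_9^+ assigned to a vertex that is switched iff e. *)
Definition tromp : finType := (bool * option F9)%type.

Definition sgn (b : bool) (t : tromp) : tromp := (~~ b (+) t.1, t.2).

Definition antipode (t : tromp) : tromp := sgn false t.

(** Positive adjacency suffices: a negative edge to [y] is a positive edge to the antipode of
    [y]. *)
Definition pos_adj (x y : tromp) : bool :=
  (x.2 != y.2) && (x.1 (+) y.1 (+) SP9p_sign x.2 y.2).

Definition nbh (x : tromp) : {set tromp} := [set y | pos_adj x y].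

Lemma F3_cases (a : 'F_3) : [\/ a = 0, a = 1 | a = 2%:R]%R.
Proof.
by case: a => [[|[|[|//]]] Ha]; [apply: Or31|apply: Or32|apply: Or33]; apply/val_inj.
Qed.

(** The squares are 0, 1, -1, i and -i, so positive edges of SP_9 are the rook moves on a 3 by 3
    board. *)
Lemma sqF9E (x : F9) : sqF9 x = (x.1 == 0%R) || (x.2 == 0%R).
Proof.
case: x => a b; apply/existsP/idP => [[[c d]] /eqP[<- <-]|] /=.
  by case: (F3_cases c) => ->; case: (F3_cases d) => ->.
have sq (c d : 'F_3) : mulF9 (c, d) (c, d) == (a, b) ->
    exists w : F9, mulF9 w w == (a, b) by exists (c, d).
case: (F3_cases a) sq => ->; case: (F3_cases b) => -> //= sq _.
- exact: (sq 0 0)%R.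
- exact: (sq 2%:R 1)%R.
- exact: (sq 1 1)%R.
- exact: (sq 1 0)%R.
- exact: (sq 0 1)%R.
Qed.

Lemma SP9p_signE (x y : option F9) :
  SP9p_sign x y =
  if (x, y) is (Some u, Some v) then (u.1 == v.1) || (u.2 == v.2) else true.
Proof.
by case: x y => [u|] [v|] //=; rewrite sqF9E /subF9 /= !GRing.subr_eq0.
Qed.

(* Destructuring down to the underlying naturals keeps the exhaustive checks
   fast: projections and the generic equality test make vm_compute evaluate the
   type arguments 'F_3 again and again. *)
Definition pt_eqb (o o' : option F9) : bool :=
  match o, o' with
  | Some (Ordinal a _, Ordinal b _), Some (Ordinal a' _, Ordinal b' _) =>
      eqn a a' && eqn b b'
  | None, None => true
  | _, _ => false
  end.

Definition tromp_eqb (x y : tromp) : bool :=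
  let: (e, o) := x in let: (e', o') := y in ~~ (e (+) e') && pt_eqb o o'.

Definition pos_adjb (x y : tromp) : bool :=
  let: (e, o) := x in let: (e', o') := y in
  match o, o' with
  | Some (Ordinal a _, Ordinal b _), Some (Ordinal a' _, Ordinal b' _) =>
      let p := eqn a a' in let q := eqn b b' in
      ~~ (p && q) && (e (+) e' (+) (p || q))
  | None, None => false
  | _, _ => ~~ (e (+) e')
  end.

Lemma pt_eqE o o' : (o == o') = pt_eqb o o'.
Proof. by case: o o' => [[[a ?] [b ?]]|] [[[a' ?] [b' ?]]|]. Qed.

Lemma tromp_eqE x y : (x == y) = tromp_eqb x y.
Proof.
by case: x y => b o [b' o']; rewrite /tromp_eqb -pt_eqE; case: b b' => [] [].
Qed.

Lemma pos_adjE x y : pos_adj x y = pos_adjb x y.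
Proof.
rewrite /pos_adj SP9p_signE.
by case: x y => e [[[a ?] [b ?]]|] [e' [[[a' ?] [b' ?]]|]] //=; rewrite addbT.
Qed.

Definition F3_enum : seq 'F_3 := [:: 0; 1; 2%:R]%R.

Definition tromp_enum : seq tromp :=
  [seq (b, o) | b <- [:: true; false],
    o <- None :: [seq Some (a, c) | a <- F3_enum, c <- F3_enum]].

Lemma mem_tromp_enum t : t \in tromp_enum.
Proof.
case: t => b o; apply: allpairs_f; first by case: b.
by case: o => [[a c]|] //; case: (F3_cases a) => ->; case: (F3_cases c) => ->.
Qed.

Lemma card_tromp (A : {pred tromp}) : #|A| = count [in A] tromp_enum.
Proof.
have U : uniq tromp_enum by vm_cast_no_check isT.
rewrite -size_filter -(card_uniqP (filter_uniq _ U)).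
by apply: eq_card => x; rewrite mem_filter mem_tromp_enum andbT.
Qed.

Lemma all_trompP (Q : pred tromp) : reflect (forall t, Q t) (all Q tromp_enum).
Proof. by apply: (iffP allP) => H x *; apply: H; rewrite ?mem_tromp_enum. Qed.

Lemma sgnK b : involutive (sgn b).
Proof. by case: b => -[[] o]. Qed.

Lemma sgn_sgn b b' t : sgn b (sgn b' t) = sgn (b == b') t.
Proof. by case: b b' t => [] [] [[] o]. Qed.

Lemma pos_adj_sgn b x y : pos_adj x (sgn b y) = pos_adj (sgn b x) y.
Proof. by rewrite /pos_adj /=; case: b x.1 y.1 => [] [] []. Qed.

Lemma pos_adj_sym x y : pos_adj x y = pos_adj y x.
Proof.
rewrite /pos_adj !SP9p_signE eq_sym (addbC x.1); congr (_ && (_ (+) _)).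
by case: x.2 y.2 => [u|] [v|] //=; rewrite (eq_sym u.1) (eq_sym u.2).
Qed.

Lemma antipode_neq x : x != antipode x.
Proof. by case: x => -[] o; rewrite xpair_eqE. Qed.

Lemma pos_adj_antipode x y z : pos_adj x y -> pos_adj x z -> y != antipode z.
Proof.
rewrite /pos_adj => /andP[_ Hy] /andP[_ Hz]; apply/eqP => E.
by move: Hy Hz; rewrite E /=; case: x.1 z.1 (SP9p_sign _ _) => [] [] [].
Qed.

Lemma pos_adj_pt x y : pos_adj x y -> x.2 != y.2.
Proof. by case/andP. Qed.

Lemma pt_eqP (x y : tromp) : reflect (x = y \/ x = antipode y) (x.2 == y.2).
Proof.
case: x y => [b o] [b' o']; rewrite /antipode /sgn /=; apply: (iffP eqP) => [->|].
  by case: b b' => [] []; auto.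
by case=> -[].
Qed.

(** * Neighbourhood counts in the double cover, by exhaustive evaluation *)

Lemma card_nbh D : #|nbh D| = 9.
Proof.
rewrite card_tromp (eq_count (a2 := pos_adjb D)) => [|x]; last first.
  by rewrite !inE pos_adjE.
move: D; suff /all_trompP H : all (fun D => count (pos_adjb D) tromp_enum == 9) tromp_enum.
  by move=> D; apply/eqP.
by vm_cast_no_check isT.
Qed.

Lemma card_nbh2 D E : D != antipode E -> 4 <= #|nbh D :&: nbh E|.
Proof.
rewrite card_tromp (eq_count (a2 := fun x =>
  pos_adjb D x && pos_adjb E x)) => [|x]; last first.
  by rewrite !inE !pos_adjE ?tromp_eqE.
rewrite tromp_eqE; apply/implyP; move: E; apply/all_trompP; move: D; apply/all_trompP.
by vm_cast_no_check isT.
Qed.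

Lemma nbh3_neq0 D E F :
  D != antipode E -> D != antipode F -> E != antipode F -> nbh D :&: nbh E :&: nbh F != set0.
Proof.
suff H : [|| D == antipode E, D == antipode F, E == antipode F | has (fun x =>
    [&& pos_adjb D x, pos_adjb E x & pos_adjb F x]) tromp_enum].
  move=> H1 H2 H3; move: H; rewrite (negbTE H1) (negbTE H2) (negbTE H3) !orFb.
  case/hasP=> x _ /and3P[Dx Ex Fx]; apply/set0Pn; exists x.
  by rewrite !inE !pos_adjE Dx Ex.
rewrite !tromp_eqE.
move: F; apply/all_trompP; move: E; apply/all_trompP; move: D; apply/all_trompP.
by vm_cast_no_check isT.
Qed.

(** Used for lists inside [nbh W]: four colours there must meet these six, since [nbh W] has only
    nine. *)
Lemma card_nbhI_nbhU W X Y :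
  X.2 != Y.2 -> X != antipode W -> Y != antipode W -> 6 <= #|nbh W :&: (nbh X :|: nbh Y)|.
Proof.
rewrite card_tromp (eq_count (a2 := fun x =>
  pos_adjb W x && (pos_adjb X x || pos_adjb Y x))) => [|x]; last first.
  by rewrite !inE !pos_adjE ?tromp_eqE.
rewrite pt_eqE !tromp_eqE => H1 H2; apply/implyP; move: H2; apply/implyP; move: H1.
apply/implyP; move: Y; apply/all_trompP; move: X; apply/all_trompP.
by move: W; apply/all_trompP; vm_cast_no_check isT.
Qed.

Lemma card_nbhU X Y : X.2 != Y.2 -> 14 <= #|nbh X :|: nbh Y|.
Proof.
rewrite card_tromp (eq_count (a2 := fun x =>
  pos_adjb X x || pos_adjb Y x)) => [|x]; last first.
  by rewrite !inE !pos_adjE ?tromp_eqE.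
rewrite pt_eqE; apply/implyP; move: Y; apply/all_trompP; move: X; apply/all_trompP.
by vm_cast_no_check isT.
Qed.

Lemma nbhI_eq0 b (A : {set tromp}) Q :
  (forall x, (x \in A) = Q x) ->
  (nbh b :&: A == set0) = ~~ has (fun x => pos_adjb b x && Q x) tromp_enum.
Proof.
move=> AQ; apply/idP/idP => [/eqP E|/hasPn H].
  apply/hasPn => x _; have := in_set0 x.
  by rewrite -E !inE pos_adjE AQ => ->.
apply/eqP/setP=> x; rewrite !inE pos_adjE AQ.
by apply/negbTE/H; rewrite mem_tromp_enum.
Qed.

(** Serves a vertex that sees the heavy colours [D] and [E] and has one forbidden colour [z]: all
    but three colours [b] of a further neighbour leave it a choice. *)
Lemma card_far_nbh2 D E z : D != antipode E ->
  #|[set b | nbh b :&: ((nbh D :&: nbh E) :\ z) == set0]| <= 3.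
Proof.
rewrite card_tromp (eq_count (a2 := fun b => ~~ has (fun x => pos_adjb b x &&
   [&& ~~ tromp_eqb x z, pos_adjb D x & pos_adjb E x]) tromp_enum)) => [|b]; last first.
  by rewrite !inE; apply: nbhI_eq0 => x; rewrite !inE !pos_adjE ?tromp_eqE.
rewrite tromp_eqE; apply/implyP; move: z; apply/all_trompP; move: E; apply/all_trompP.
by move: D; apply/all_trompP; vm_cast_no_check isT.
Qed.

(** The version for a triangle: [Q] is the colour of one end seen from the middle, and [sgn t Q] is
    what the other end must respect, with [t] the sign of the triangle. *)
Lemma card_far_nbh2_in t Q E z : E != antipode (sgn t Q) ->
  #|[set b in nbh Q | nbh b :&: ((nbh (sgn t Q) :&: nbh E) :\ z) == set0]| <= 2.
Proof.
rewrite card_tromp (eq_count (a2 := fun b => pos_adjb Q b && ~~ has (fun x =>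
   pos_adjb b x && [&& ~~ tromp_eqb x z, pos_adjb (sgn t Q) x & pos_adjb E x])
     tromp_enum)) => [|b]; last first.
  rewrite !inE pos_adjE; congr (_ && _).
  by apply: nbhI_eq0 => x; rewrite !inE !pos_adjE ?tromp_eqE.
rewrite tromp_eqE; apply/implyP; move: z; apply/all_trompP; move: E; apply/all_trompP.
by move: Q; apply/all_trompP; case: t; vm_cast_no_check isT.
Qed.

(** A colour of [nbh C] outside this set has two neighbours in the list, necessarily with different
    points, so that one prescribed point can be avoided. *)
Lemma card_near1 C D E : D != antipode E ->
  #|[set b in nbh C | #|nbh b :&: (nbh D :&: nbh E)| <= 1]| <= 5.
Proof.
rewrite card_tromp (eq_count (a2 := fun b => pos_adjb C b && (count (fun x =>
   [&& pos_adjb b x, pos_adjb D x & pos_adjb E x])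
     tromp_enum <= 1))) => [|b]; last first.
  rewrite !inE pos_adjE card_tromp; congr (_ && (_ <= _)).
  by apply: eq_count => x; rewrite !inE !pos_adjE ?tromp_eqE.
rewrite tromp_eqE; apply/implyP; move: E; apply/all_trompP; move: D; apply/all_trompP.
by move: C; apply/all_trompP; vm_cast_no_check isT.
Qed.

Lemma card_near0 D E : D != antipode E ->
  #|[set b | nbh b :&: (nbh D :&: nbh E) == set0]| <= 2.
Proof.
rewrite card_tromp (eq_count (a2 := fun b => ~~ has (fun x =>
   pos_adjb b x && (pos_adjb D x && pos_adjb E x)) tromp_enum)) => [|b]; last first.
  by rewrite !inE; apply: nbhI_eq0 => x; rewrite !inE !pos_adjE ?tromp_eqE.
rewrite tromp_eqE; apply/implyP; move: E; apply/all_trompP; move: D; apply/all_trompP.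
by vm_cast_no_check isT.
Qed.

(** Colours with the same point are equal or antipodal, and antipodal colours have no common
    neighbour. *)
Lemma nbh_pt D X X' : X \in nbh D -> X' \in nbh D -> X != X' -> X.2 != X'.2.
Proof.
rewrite !inE => DX DX' XX'; apply/pt_eqP => -[] E.
  by rewrite E eqxx in XX'.
by move: (pos_adj_antipode DX DX'); rewrite E eqxx.
Qed.

Lemma mem_nbh_sgn b X A : (sgn b X \in nbh A) = (X \in nbh (sgn b A)).
Proof. by rewrite !inE pos_adj_sgn. Qed.

Lemma sgn_antipode b A : sgn b (antipode A) = antipode (sgn b A).
Proof. by rewrite /antipode !sgn_sgn eq_sym. Qed.

(** * Colours compatible with a set of coloured vertices *)

Definition common_nbh (V : finType) (A : {set V}) (f : V -> tromp) : {set tromp} :=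
  [set X | [forall y in A, pos_adj X (f y)]].

Section CommonNeighbours.
Variables (V : finType) (f : V -> tromp).
Implicit Types (A : {set V}).

Lemma common_nbhP A X :
  reflect {in A, forall y, pos_adj X (f y)} (X \in common_nbh A f).
Proof. by rewrite inE; apply: (iffP forall_inP). Qed.

Lemma card_common_nbh0 A : #|A| = 0 -> #|common_nbh A f| = 20.
Proof.
move/eqP; rewrite cards_eq0 => /eqP->.
rewrite (_ : common_nbh _ _ = setT) ?cardsT ?card_tromp //.
by apply/setP=> X; rewrite !inE; apply/forall_inP => y; rewrite inE.
Qed.

Lemma common_nbh1 A : #|A| = 1 -> exists D, common_nbh A f = nbh D.
Proof.
move/eqP/cards1P => [y ->]; exists (f y); apply/setP=> X; rewrite [RHS]inE.
apply/common_nbhP/idP => [H|H z /set1P->]; last by rewrite pos_adj_sym.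
by rewrite pos_adj_sym H ?set11.
Qed.

Lemma common_nbh2 A : #|A| = 2 ->
  {in A &, forall y z, f y != antipode (f z)} ->
  exists D E, D != antipode E /\ common_nbh A f = nbh D :&: nbh E.
Proof.
move/eqP/cards2P => [y [z [yz ->]]] H; exists (f y), (f z).
split; first by apply: H; rewrite !inE eqxx ?orbT.
apply/setP=> X; rewrite [RHS]inE [X in X && _]inE [X in _ && X]inE.
rewrite !(pos_adj_sym _ X); apply/common_nbhP/andP => [K|[K1 K2] w].
  by rewrite !K // !inE eqxx ?orbT.
by rewrite !inE => /orP[] /eqP->.
Qed.

Lemma common_nbh3 A : #|A| = 3 ->
  {in A &, forall y z, f y != antipode (f z)} -> common_nbh A f != set0.
Proof.
move=> A3; have /card_gt0P[y yA] : 0 < #|A| by rewrite A3.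
move=> H; move/eqP: A3; rewrite (cardsD1 y) yA eqSS => A2.
have /cards2P[z [w [zw E]]] := A2.
have zA : z \in A.
  by apply: (subsetP (subD1set A y)); rewrite E !inE eqxx.
have wA : w \in A.
  by apply: (subsetP (subD1set A y)); rewrite E !inE eqxx orbT.
have /set0Pn[X] := nbh3_neq0 (H y z yA zA) (H y w yA wA) (H z w zA wA).
rewrite !inE => /andP[/andP[Xy Xz] Xw]; apply/set0Pn; exists X.
apply/common_nbhP => v vA; rewrite pos_adj_sym.
have : v \in y |: (A :\ y) by rewrite setD1K.
by rewrite E !inE => /or3P[] /eqP->.
Qed.

Lemma card_common_nbh_le2 A : #|A| <= 2 ->
  {in A &, forall y z, f y != antipode (f z)} -> 4 <= #|common_nbh A f|.
Proof.
move=> A2 H; case E : #|A| A2 => [|[|[|//]]] _.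
- by rewrite card_common_nbh0.
- by have [D ->] := common_nbh1 E; rewrite card_nbh.
- by have [D [D' [DE ->]]] := common_nbh2 E H; apply: card_nbh2.
Qed.

Lemma common_nbh_le3 A : #|A| <= 3 ->
  {in A &, forall y z, f y != antipode (f z)} -> common_nbh A f != set0.
Proof.
move=> A3 H; have [A2|A2] := leqP #|A| 2.
  by rewrite -card_gt0; apply: leq_trans (card_common_nbh_le2 A2 H).
by apply: common_nbh3 => //; apply/eqP; rewrite eqn_leq A3.
Qed.

End CommonNeighbours.

(** * Sign-respecting colourings and an edge-minimal counterexample *)

Definition proper_col (V : finType) (sg : V -> V -> bool) (adj : rel V)
    (c : V -> tromp) : Prop :=
  forall x y, adj x y -> pos_adj (c x) (sgn (sg x y) (c y)).

Section Minimal.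
Variables (V : finType) (adj : rel V) (sg : V -> V -> bool).
Hypothesis adjC : symmetric adj.
Hypothesis adjI : irreflexive adj.
Hypothesis sgC : forall x y, adj x y -> sg x y = sg y x.
Hypothesis not_col : forall c, ~ proper_col sg adj c.
Hypothesis min_col : forall adj' : rel V, symmetric adj' -> subrel adj' adj ->
  (exists x y, adj x y && ~~ adj' x y) -> exists c, proper_col sg adj' c.

Definition nb x : {set V} := [set y | adj x y].
Definition light x : bool := #|nb x| <= 3.
(** What [y] demands of [x] across the edge: the edge is respected iff the colour of [x] lies in
    [nbh (seen c x y)]. *)
Definition seen (c : V -> tromp) x y : tromp := sgn (sg x y) (c y).
Definition upd (c : V -> tromp) x X : V -> tromp :=
  fun z => if z == x then X else c z.

Definition del (r : rel V) : rel V := [rel x y | [&& adj x y, ~~ r x y & ~~ r y x]].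

Lemma delE r x y : del r x y = [&& adj x y, ~~ r x y & ~~ r y x].
Proof. by []. Qed.

Lemma del_sym r : symmetric (del r).
Proof. by move=> x y; rewrite !delE adjC [~~ r x y && _]andbC. Qed.

Lemma del_sub r : subrel (del r) adj.
Proof. by move=> x y; case/and3P. Qed.

Lemma min_col_del (r : rel V) x y : adj x y -> r x y ->
  exists c, proper_col sg (del r) c.
Proof.
move=> xy rxy; apply: min_col.
- exact: del_sym.
- exact: del_sub.
- by exists x, y; rewrite delE xy rxy.
Qed.

Lemma pos_adj_seenC c x y : adj x y ->
  pos_adj (c x) (seen c x y) -> pos_adj (c y) (seen c y x).
Proof. by move=> xy; rewrite /seen pos_adj_sgn pos_adj_sym sgC. Qed.

Lemma proper_compat (adj' : rel V) c u y z : proper_col sg adj' c ->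
  adj' u y -> adj' u z -> seen c u y != antipode (seen c u z).
Proof. by move=> H /H uy /H uz; apply: pos_adj_antipode uy uz. Qed.

Lemma nb_neq x y : adj x y -> x != y.
Proof. by apply: contraTneq => ->; rewrite adjI. Qed.

Lemma upd_proper (adj' : rel V) c x X : symmetric adj' -> subrel adj' adj ->
  (forall a b, adj' a b -> a != x -> b != x -> pos_adj (c a) (seen c a b)) ->
  (forall z, adj' x z -> pos_adj X (seen c x z)) ->
  proper_col sg adj' (upd c x X).
Proof.
move=> symA subA H HX a b ab; rewrite -/(seen _ a b).
have key z : adj' x z -> pos_adj (upd c x X x) (seen (upd c x X) x z).
  move=> xz; have := nb_neq (subA _ _ xz); rewrite eq_sym => /negbTE zx.
  by rewrite /seen /upd eqxx zx; apply: HX.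
have [ax|ax] := eqVneq a x; first by rewrite ax; apply: key; rewrite -ax.
have [bx|bx] := eqVneq b x.
  apply: pos_adj_seenC; first by rewrite adjC; apply: subA.
  by rewrite bx; apply: key; rewrite -bx symA.
by rewrite /seen /upd (negbTE ax) (negbTE bx); apply: H.
Qed.

(** Otherwise [xy] is the only edge at [x]; once it is deleted, [x] can be recoloured by any
    neighbour of the colour seen through it. *)
Lemma deg_ge2 x y : adj x y -> 2 <= #|nb x|.
Proof.
move=> xy; rewrite ltnNge; apply/negP => x1.
have nbE z : adj x z -> z = y.
  move=> xz; apply/eqP; apply: contraTT x1 => zy; rewrite -ltnNge.
  by apply/card_gt1P; exists z, y; rewrite !inE.
have [c cP] := min_col_del (r := [rel a b | a == x]) xy (eqxx x).
have /card_gt0P[X] : 0 < #|nbh (seen c x y)| by rewrite card_nbh.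
rewrite inE pos_adj_sym => XP; apply: (not_col (c := upd c x X)).
apply: upd_proper => // [a b ab ax bx|z /nbE->//].
by apply: cP; rewrite delE /= ab ax bx.
Qed.

(** Only the edge [xy] is deleted, and both ends have at most two other neighbours. First [x] is
    recoloured, among at least four colours, so that [y] sees pairwise non-antipodal colours; then
    [y] is. *)
Lemma light_indep x y : adj x y -> light x -> ~~ light y.
Proof.
move=> xy x3; apply/negP => y3.
have xNy := nb_neq xy.
have [c cP] := min_col_del (r := [rel a b | (a == x) && (b == y)]) xy
  (introT andP (conj (eqxx x) (eqxx y))).
have cPx z : z \in nb x :\ y -> pos_adj (c x) (seen c x z).
  rewrite !inE => /andP[zy xz]; apply: cP.
  by rewrite delE /= xz (negbTE zy) (negbTE xNy) !andbF.
have cPy z : z \in nb y :\ x -> pos_adj (c y) (seen c y z).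
  rewrite !inE => /andP[zx yz]; apply: cP.
  by rewrite delE /= yz (negbTE zx) eq_sym (negbTE xNy).
(* The colours of [x] that [y] would see as antipodal to the colour of another of its neighbours. *)
set F := [set sgn (sg y x) (antipode (seen c y z)) | z in nb y :\ x].
have F2 : #|F| <= 2.
  apply: leq_trans (leq_imset_card _ _) _; rewrite -ltnS.
  by move: y3; rewrite /light (cardsD1 x) inE adjC xy.
have L4 : 4 <= #|common_nbh (nb x :\ y) (seen c x)|.
  apply: card_common_nbh_le2 => [|a b /cPx aP /cPx bP].
    by move: x3; rewrite /light (cardsD1 y) inE xy.
  exact: pos_adj_antipode aP bP.
have /card_gt0P[X] : 0 < #|common_nbh (nb x :\ y) (seen c x) :\: F|.
  have := subset_leq_card (subsetIr (common_nbh (nb x :\ y) (seen c x)) F).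
  by rewrite cardsD; move: L4 F2; card_lia.
rewrite inE => /andP[XF /common_nbhP XP].
pose c1 := upd c x X.
have c1E z : z != x -> c1 z = c z by rewrite /c1 /upd => /negbTE->.
have c1x : c1 x = X by rewrite /c1 /upd eqxx.
have XFz z : z \in nb y :\ x -> seen c1 y x != antipode (seen c1 y z).
  move=> zP; apply: contraNneq XF => /(congr1 (sgn (sg y x))).
  rewrite {1}/seen sgnK c1x => ->; apply/imsetP; exists z => //.
  by rewrite /seen c1E //; move: zP; rewrite !inE => /andP[].
have /set0Pn[Y /common_nbhP YP] : common_nbh (nb y) (seen c1 y) != set0.
  apply: common_nbh_le3 => // a b.
  have xNb : x \in nb y by rewrite inE adjC.
  rewrite -(setD1K xNb) !in_setU1.
  case/orP=> [/eqP->|aP] /orP[/eqP->|bP].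
  - exact: antipode_neq.
  - exact: XFz.
  - apply: contraTneq (XFz a aP) => ->.
    by rewrite /antipode sgnK eqxx.
  - have /setD1P[ax _] := aP; have /setD1P[bx _] := bP.
    by rewrite /seen !c1E //; apply: pos_adj_antipode (cPy a aP) (cPy b bP).
apply: (not_col (c := upd c1 y Y)); apply: upd_proper => // [a b ab ay by_|z yz].
  have : proper_col sg (del [rel a b | a == y]) c1.
    apply: upd_proper => [||d e|z]; [exact: del_sym|exact: del_sub|..].
      rewrite delE => /and3P[de dy ey] dx ex; apply: cP.
      by rewrite delE /= de (negbTE ex) (negbTE dx).
    by rewrite delE => /and3P[xz _ zy]; apply: XP; rewrite !inE zy.
  by apply; rewrite delE /= ab ay by_.
by apply: YP; rewrite inE.
Qed.

(** A light vertex sees at most three pairwise non-antipodal colours, which have a common neighbour;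
    light vertices are independent, so these choices do not interact. *)
Lemma extend_light c :
  (forall x y, ~~ light x -> ~~ light y -> adj x y -> pos_adj (c x) (seen c x y)) ->
  (forall u y z, light u -> adj u y -> adj u z ->
    seen c u y != antipode (seen c u z)) -> False.
Proof.
move=> Hheavy Hlight.
(* The default [c u] only makes [f] total; it is never reached at a light [u]. *)
pose f u := odflt (c u) [pick X in common_nbh (nb u) (seen c u)].
have fP u y : light u -> adj u y -> pos_adj (f u) (seen c u y).
  move=> lu uy; rewrite /f; case: pickP => [X /common_nbhP|no] /=.
    by apply; rewrite inE.
  have /set0Pn[X] : common_nbh (nb u) (seen c u) != set0.
    by apply: common_nbh_le3 => // y1 z1; rewrite !inE; apply: Hlight.
  by rewrite no.
apply: (not_col (c := fun x => if light x then f x else c x)) => x y xy.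
have [lx|hx] := boolP (light x).
  by rewrite (negbTE (light_indep xy lx)); apply: fP.
have [ly|hy] := boolP (light y); last exact: Hheavy.
rewrite pos_adj_sgn pos_adj_sym sgC //.
by apply: fP; rewrite // adjC.
Qed.

(** * Colour lists of uncoloured heavy vertices *)

Definition heavy_nb x : {set V} := [set y in nb x | ~~ light y].
(* Each (u, z) in weak_link Y x forbids the single colour [forbidden c x (u, z)]
   at x: the one antipodal to the colour of z when both are seen from u. *)
Definition weak_link (Y : {set V}) x : {set V * V} :=
  [set p | [&& adj x p.1, light p.1, adj p.1 p.2 & p.2 \notin Y]].
Definition weak_deg x : nat := #|weak_link [set x] x|.
Definition forbidden (c : V -> tromp) x (p : V * V) : tromp :=
  sgn (sg p.1 x) (antipode (seen c p.1 p.2)).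
Definition strong_colors (Y : {set V}) c x : {set tromp} :=
  common_nbh (heavy_nb x :\: Y) (seen c x).
Definition colors (Y : {set V}) c x : {set tromp} :=
  strong_colors Y c x :\: [set forbidden c x p | p in weak_link Y x].
(** Edges from [Y] to heavy vertices outside [Y] are kept: the old colour of a vertex of [Y] then
    witnesses that the colours it sees there are pairwise non-antipodal. *)
Definition uncolored (Y : {set V}) : rel V :=
  [rel x y | (x \in Y) && (light y || (y \in Y))].
Definition linked x y : bool := [exists u, [&& light u, adj x u & adj y u]].

Lemma uncoloredE (Y : {set V}) x y : del (uncolored Y) x y =
  [&& adj x y, ~~ ((x \in Y) && (light y || (y \in Y)))
    & ~~ ((y \in Y) && (light x || (x \in Y)))].
Proof. by []. Qed.

(* Adjacent vertices of Y have distinct points, so the light vertices joining them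
   impose nothing; for non-adjacent ones it suffices to ask for distinct points. *)
Lemma reduce (Y : {set V}) c c' :
  proper_col sg (del (uncolored Y)) c ->
  {in Y, forall y, ~~ light y} ->
  (forall x, x \notin Y -> c' x = c x) ->
  {in Y, forall x, c' x \in colors Y c x} ->
  {in Y &, forall x v, adj x v -> pos_adj (c' x) (seen c' x v)} ->
  {in Y &, forall x v, x != v -> ~~ adj x v -> linked x v -> (c' x).2 != (c' v).2} ->
  False.
Proof.
move=> cP hY c'E c'L c'A c'W.
have Yl u : light u -> u \notin Y by move=> lu; apply: contraL lu; apply: hY.
apply: (extend_light (c := c')) => [x y hx hy xy | u y z lu uy uz].
  have out a b : a \in Y -> b \notin Y -> ~~ light b -> adj a b ->
      pos_adj (c' a) (seen c' a b).
    move=> aY bY hb ab; have := c'L a aY; rewrite in_setD => /andP[_ /common_nbhP H].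
    by rewrite /seen (c'E b) //; apply: H; rewrite !inE bY ab.
  have [xY|xY] := boolP (x \in Y); have [yY|yY] := boolP (y \in Y).
  - exact: c'A.
  - exact: out.
  - by apply: pos_adj_seenC; [rewrite adjC|apply: out => //; rewrite adjC].
  - rewrite /seen !c'E //; apply: cP.
    by rewrite uncoloredE xy /= (negbTE xY) (negbTE yY).
(* An antipodal clash at [u] would come from the link [(u, b)] of [a], whose forbidden colour is not
   in the list of [a]. *)
have io a b : a \in Y -> b \notin Y -> adj u a -> adj u b ->
    seen c' u a != antipode (seen c' u b).
  move=> aY bY ua ub; apply: contraTneq (c'L a aY) => /(congr1 (sgn (sg u a))).
  rewrite {1}/seen sgnK => ->; rewrite inE negb_and negbK; apply/orP; left.
  apply/imsetP; exists (u, b); first by rewrite inE /= lu adjC ua ub bY.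
  by rewrite /seen (c'E b).
have ad a : seen c' u a != antipode (seen c' u a) by apply: antipode_neq.
have [yY|yY] := boolP (y \in Y); have [zY|zY] := boolP (z \in Y).
- have [<-//|yz] := eqVneq y z.
  have pt : (c' y).2 != (c' z).2.
    have [ayz|nyz] := boolP (adj y z).
      by have := pos_adj_pt (c'A y z yY zY ayz).
    by apply: c'W => //; apply/existsP; exists u; rewrite lu !(adjC _ u) uy uz.
  by apply: contraNneq pt => E; have := congr1 snd E => /= ->.
- exact: io.
- apply: contraTneq (io z y zY yY uz uy) => ->.
  by rewrite /antipode sgnK eqxx.
- have uN : u \notin Y by apply: Yl.
  rewrite /seen !c'E //; apply: (proper_compat cP);
    by rewrite uncoloredE /= ?uy ?uz (negbTE uN) ?(negbTE yY) ?(negbTE zY).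
Qed.

Section Lists.
Variables (Y : {set V}) (c : V -> tromp).
Hypothesis cP : proper_col sg (del (uncolored Y)) c.

Lemma seen_compat x :
  {in heavy_nb x :\: Y &, forall y z, seen c x y != antipode (seen c x z)}.
Proof.
have key y : y \in heavy_nb x :\: Y -> pos_adj (c x) (seen c x y).
  rewrite !inE => /andP[yY /andP[xy hy]]; apply: cP.
  by rewrite uncoloredE xy /= (negbTE hy) (negbTE yY) andbF.
by move=> y z /key yP /key; apply: pos_adj_antipode.
Qed.

Lemma leq_card_colorsI x (A : {set tromp}) :
  #|strong_colors Y c x :&: A| <= #|colors Y c x :&: A| + #|weak_link Y x|.
Proof.
rewrite addnC -leq_subLR setIDAC cardsD; apply: leq_sub2l.
apply: leq_trans (leq_imset_card (forbidden c x) (mem (weak_link Y x))).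
exact: subset_leq_card (subsetIr _ _).
Qed.

Lemma leq_card_colors x :
  #|strong_colors Y c x| <= #|colors Y c x| + #|weak_link Y x|.
Proof. by rewrite -[strong_colors _ _ _]setIT -[colors _ _ _]setIT leq_card_colorsI. Qed.

Lemma colors_sub x : colors Y c x \subset strong_colors Y c x.
Proof. exact: subsetDl. Qed.

Lemma colors_weak1 x : #|weak_link Y x| <= 1 ->
  exists z, strong_colors Y c x :\ z \subset colors Y c x.
Proof.
move=> W1; have : #|[set forbidden c x p | p in weak_link Y x]| <= 1.
  exact: leq_trans (leq_imset_card _ _) W1.
rewrite /colors leq_eqVlt ltnS leqn0 cards_eq0 => /orP[/cards1P[z ->]|/eqP->].
  by exists z.
(* Nothing is forbidden here; the removed colour is arbitrary. *)
by exists (true, None); rewrite setD0 subD1set.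
Qed.

Lemma weak_link_le x : x \in Y -> #|weak_link Y x| <= weak_deg x.
Proof.
move=> xY; apply: subset_leq_card; apply/subsetP => p.
rewrite !inE => /and4P[-> -> -> pY] /=.
by apply: contraNneq pY => ->.
Qed.

(** A light [u] joining [x] to [v] gives the pair [(u, v)], which [weak_deg x] counts and
    [weak_link Y x] does not. *)
Lemma weak_link_lt x v : x \in Y -> v \in Y -> x != v -> linked x v ->
  #|weak_link Y x| < weak_deg x.
Proof.
move=> xY vY xv /existsP[u /and3P[lu xu vu]]; apply: proper_card.
apply/properP; split; last first.
  exists (u, v); first by rewrite !inE /= xu lu adjC vu eq_sym.
  by rewrite !inE /= vY !andbF.
apply/subsetP => p; rewrite !inE => /and4P[-> -> -> pY] /=.
by apply: contraNneq pY => ->.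
Qed.

Lemma strong_colors0 x :
  #|heavy_nb x :\: Y| = 0 -> #|strong_colors Y c x| = 20.
Proof. exact: card_common_nbh0. Qed.

Lemma strong_colors1 x : #|heavy_nb x :\: Y| = 1 ->
  exists D, strong_colors Y c x = nbh D.
Proof. exact: common_nbh1. Qed.

Lemma strong_colors2 x : #|heavy_nb x :\: Y| = 2 ->
  exists D E, D != antipode E /\ strong_colors Y c x = nbh D :&: nbh E.
Proof. by move=> s2; apply: common_nbh2 => // y z; apply: seen_compat. Qed.

End Lists.

(** * Reducible configurations of one, two and three heavy vertices *)

Lemma heavy_nbC x y : ~~ light x -> y \in heavy_nb x -> x \in heavy_nb y.
Proof. by rewrite !inE adjC => hx /andP[-> _]. Qed.

Lemma heavy_nb_irr x : x \notin heavy_nb x.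
Proof. by rewrite !inE adjI. Qed.

Lemma heavy_nb_set1 x : heavy_nb x :\: [set x] = heavy_nb x.
Proof. by apply/setDidPl; rewrite disjoint_sym disjoints1 heavy_nb_irr. Qed.

(** A colour left in the list of [x] would extend to the whole graph, so the forbidden colours
    exhaust the strong ones. *)
Lemma single_reduction x u : ~~ light x -> adj x u -> light u ->
  exists2 c, proper_col sg (del (uncolored [set x])) c &
    #|strong_colors [set x] c x| <= weak_deg x.
Proof.
move=> hx xu lu.
have [|c cP] := min_col_del (r := uncolored [set x]) xu.
  by rewrite /uncolored /= set11 lu.
exists c => //; apply: leq_trans (leq_card_colors _ _ _) _.
rewrite (_ : colors [set x] c x = set0) ?cards0 ?weak_link_le ?set11 //.
apply/eqP; apply/set0Pn => -[X XP].
apply: (reduce (c' := upd c x X) cP) => [y|y|y|y z|y z].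
- by move/set1P->.
- by rewrite inE /upd => /negbTE->.
- by move/set1P->; rewrite /upd eqxx.
- by move=> /set1P-> /set1P->; rewrite adjI.
- by move=> /set1P-> /set1P->; rewrite eqxx.
Qed.

Lemma weak_deg_min x u : ~~ light x -> adj x u -> light u ->
  [/\ #|heavy_nb x| = 0 -> 20 <= weak_deg x,
      #|heavy_nb x| = 1 -> 9 <= weak_deg x &
      #|heavy_nb x| = 2 -> 4 <= weak_deg x].
Proof.
move=> hx xu lu; have [c cP] := single_reduction hx xu lu.
have := strong_colors2 cP (x := x).
have := strong_colors1 c (Y := [set x]) (x := x).
have := strong_colors0 c (Y := [set x]) (x := x).
rewrite heavy_nb_set1 => H0 H1 H2 H; split=> E; apply: leq_trans H.
- by rewrite H0.
- by have [D ->] := H1 E; rewrite card_nbh.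
- by have [D [D' [DD' ->]]] := H2 E; apply: card_nbh2.
Qed.

(** The edges [xa] and [xb] already force distinct points on their ends, so light links along them
    impose nothing; only a link between non-adjacent [a] and [b] needs a condition. *)
Lemma triple_reduction a x b : a \in heavy_nb x -> b \in heavy_nb x ->
  a != b -> ~~ light x ->
  let Y := [set a; x; b] in
  exists2 c, proper_col sg (del (uncolored Y)) c &
    forall A X B, A \in colors Y c a -> X \in colors Y c x -> B \in colors Y c b ->
    pos_adj X (sgn (sg x a) A) -> pos_adj X (sgn (sg x b) B) ->
    (adj a b -> pos_adj A (sgn (sg a b) B)) ->
    (~~ adj a b -> linked a b -> A.2 != B.2) -> False.
Proof.
rewrite !inE => /andP[xa ha] /andP[xb hb] ab hx Y.
have [|c cP] := min_col_del (r := uncolored Y) xa.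
  by rewrite /uncolored /= !inE !eqxx !orbT.
exists c => // A X B AP XP BP XA XB AB ABw.
have xNa := nb_neq xa; have xNb := nb_neq xb.
pose c' := upd (upd (upd c b B) x X) a A.
have c'a : c' a = A by rewrite /c' /upd eqxx.
have c'x : c' x = X by rewrite /c' /upd (negbTE xNa) eqxx.
have c'b : c' b = B.
  by rewrite /c' /upd eqxx [b == x]eq_sym [b == a]eq_sym (negbTE ab) (negbTE xNb).
have ok u v : adj u v -> pos_adj (c' u) (seen c' u v) ->
  pos_adj (c' u) (seen c' u v) /\ pos_adj (c' v) (seen c' v u).
  by move=> uv H; split=> //; apply: pos_adj_seenC.
have [xaP axP] : _ /\ _ := ok x a xa (ltac:(by rewrite /seen c'x c'a)).
have [xbP bxP] : _ /\ _ := ok x b xb (ltac:(by rewrite /seen c'x c'b)).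
have abP : adj a b ->
    pos_adj (c' a) (seen c' a b) /\ pos_adj (c' b) (seen c' b a).
  by move=> H; apply: ok => //; rewrite /seen c'a c'b; apply: AB.
apply: (reduce (c' := c') cP) => [y|y|y|y z|y z].
- by case/set3P=> ->.
- rewrite !inE -orbA !negb_or /c' /upd => /and3P[/negbTE-> /negbTE-> /negbTE->] //.
- by case/set3P=> ->; rewrite ?c'a ?c'x ?c'b.
- move=> /set3P[]-> /set3P[]-> //; rewrite ?adjI //.
  + by case/abP.
  + by rewrite adjC => /abP[].
- move=> /set3P[]-> /set3P[]->; rewrite ?eqxx //;
    rewrite ?[adj _ x]adjC ?xa ?xb // ?c'a ?c'b.
  + by move=> _; apply: ABw.
  + rewrite adjC eq_sym => _ nab /existsP[u /and3P[lu bu au]].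
    rewrite eq_sym; apply: ABw => //.
    by apply/existsP; exists u; rewrite lu au bu.
Qed.

Lemma pair_reduction x v : v \in heavy_nb x -> ~~ light x ->
  let Y := [set x; v] in
  exists2 c, proper_col sg (del (uncolored Y)) c &
    forall X X', X \in colors Y c x -> X' \in colors Y c v ->
    pos_adj X (sgn (sg x v) X') -> False.
Proof.
rewrite !inE => /andP[xv hv] hx Y.
have [|c cP] := min_col_del (r := uncolored Y) xv.
  by rewrite /uncolored /= !inE !eqxx !orbT.
exists c => // X X' XP X'P XX'.
have xNv := nb_neq xv.
pose c' := upd (upd c v X') x X.
have c'x : c' x = X by rewrite /c' /upd eqxx.
have c'v : c' v = X' by rewrite /c' /upd eqxx eq_sym (negbTE xNv).
have xvP : pos_adj (c' x) (seen c' x v) by rewrite /seen c'x c'v.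
apply: (reduce (c' := c') cP) => [y|y|y|y z|y z].
- by case/set2P=> ->.
- by rewrite !inE !negb_or /c' /upd => /andP[/negbTE-> /negbTE->].
- by case/set2P=> ->; rewrite ?c'x ?c'v.
- move=> /set2P[]-> /set2P[]-> //; rewrite ?adjI // => _.
  exact: pos_adj_seenC.
- move=> /set2P[]-> /set2P[]->; rewrite ?eqxx //.
    by rewrite xv.
  by rewrite adjC xv.
Qed.

Lemma card_heavy_nb_pair x v : v \in heavy_nb x ->
  #|heavy_nb x| = #|heavy_nb x :\: [set x; v]|.+1.
Proof.
move=> vx; rewrite (cardsD1 v) vx; congr (_.+1); apply: eq_card => y.
rewrite !in_setD !in_set2 in_set1 negb_or -andbA; case: (eqVneq y x) => [->|_] //=.
by rewrite (negbTE (heavy_nb_irr x)) !andbF.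
Qed.

(** The list of [x] has at least 9 - 5 = 4 colours inside [nbh W]; that of [v] has at least 9 - 5 or
    4 - 1, inside some [nbh D]. Two suitable colours at [v] reach six of the nine in [nbh W], hence
    one in the list of [x]. *)
Lemma pair_excluded x v : ~~ light x -> v \in heavy_nb x ->
  #|heavy_nb x| = 2 -> weak_deg x <= 5 ->
  (#|heavy_nb v| = 2 /\ weak_deg v <= 5) \/ (#|heavy_nb v| = 3 /\ weak_deg v <= 1) ->
  False.
Proof.
move=> hx xv sx wx Hv; have [c cP H] := pair_reduction xv hx.
have xv' := heavy_nbC hx xv.
have ox := card_heavy_nb_pair xv; have ov := card_heavy_nb_pair xv'; rewrite [[set v; x]]setUC in ov.
set Y := [set x; v] in ox ov c cP H.
have xY : x \in Y by rewrite !inE eqxx.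
have vY : v \in Y by rewrite !inE eqxx orbT.
have Wx := weak_link_le xY; have Wv := weak_link_le vY.
have [|W EW] := strong_colors1 c (Y := Y) (x := x); first by move: ox sx; card_lia.
have Lx := leq_card_colors Y c x; rewrite EW card_nbh in Lx.
have Lxs := colors_sub Y c x; rewrite EW in Lxs.
have Lv := leq_card_colors Y c v; have Lvs := colors_sub Y c v.
have [D Lvs' Lv3] : exists2 D, colors Y c v \subset nbh D & 3 <= #|colors Y c v|.
  case: Hv => -[sv wv].
    have [|D ED] := strong_colors1 c (Y := Y) (x := v); first by move: ov sv; card_lia.
    by exists D; [rewrite -ED | rewrite ED card_nbh in Lv; move: Lv Wv wv; card_lia].
  have [|D [E [DE EDE]]] := strong_colors2 cP (x := v); first by move: ov sv; card_lia.
  exists D; first by apply: subset_trans Lvs _; rewrite EDE subsetIl.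
  by have := card_nbh2 DE; rewrite EDE in Lv; move: Lv Wv wv; card_lia.
(* Seen from [x], the colour [w] is the antipode of [W]; it is dropped so that [card_nbhI_nbhU]
   applies. *)
set t := sg x v in H; set w := sgn t (antipode W).
have /card_gt1P[X1 [X2 []]] : 1 < #|colors Y c v :\ w|.
  by have := leq_card_setD1 (colors Y c v) w; move: Lv3; card_lia.
rewrite !in_setD1 => /andP[X1w X1L] /andP[X2w X2L] X12.
have pt : (sgn t X1).2 != (sgn t X2).2.
  by apply: nbh_pt X12; apply: (subsetP Lvs').
have nw X : X != w -> sgn t X != antipode W.
  by apply: contraNneq => E; rewrite /w -E sgnK.
have G := card_nbhI_nbhU pt (nw _ X1w) (nw _ X2w).
have [|X] := subset_meet Lxs (subsetIl _ (nbh (sgn t X1) :|: nbh (sgn t X2))).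
  by rewrite card_nbh; move: wx Wx Lx G; card_lia.
rewrite in_setI => /andP[XL]; rewrite in_setI => /andP[_].
by rewrite in_setU !inE !(pos_adj_sym _ X) => /orP[]; apply: H.
Qed.

Section Path.
Variables (a x b : V).
Hypotheses (xa : a \in heavy_nb x) (xb : b \in heavy_nb x) (ab : a != b).
Hypothesis hx : ~~ light x.
Let Y := [set a; x; b].

Lemma card_heavy_nb_mid : #|heavy_nb x| = #|heavy_nb x :\: Y|.+2.
Proof.
have ba : b \in heavy_nb x :\ a by rewrite in_setD1 xb eq_sym ab.
rewrite (cardsD1 a) xa (cardsD1 b) ba; congr (_.+2); apply: eq_card => y.
rewrite !in_setD1 in_setD /Y !inE !negb_or.
by have [->|_] := eqVneq y x; rewrite ?adjI ?andbF // andbT andbCA andbA.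
Qed.

Lemma card_heavy_nb_end : #|heavy_nb a| = #|heavy_nb a :\: Y| + (adj a b) + 1.
Proof.
have ax := heavy_nbC hx xa.
rewrite (cardsD1 x) ax addnC; congr (_ + 1).
have aY : a \notin heavy_nb a := heavy_nb_irr a.
have hb : ~~ light b by move: xb; rewrite inE => /andP[].
rewrite (cardsD1 b) in_setD1 [b \in heavy_nb a]inE hb andbT inE.
have bx : b != x by rewrite eq_sym; apply: nb_neq; move: xb; rewrite !inE => /andP[].
rewrite bx andTb addnC; congr (_ + _); apply: eq_card => y.
rewrite !in_setD1 in_setD /Y !in_setU !in_set1 !negb_or.
have [->|_] := eqVneq y a; first by rewrite (negbTE aY) !andbF.
by rewrite /= -!andbA andbCA.
Qed.

End Path.

(** The middle vertex sees one outer heavy colour [C] and keeps at least 9 - 1 = 8 colours. The ends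
    are adjacent, or linked by a light vertex, or neither. *)
Lemma path333_excluded a x b : a \in heavy_nb x -> b \in heavy_nb x ->
  a != b -> ~~ light x ->
  {in [set a; x; b], forall y, #|heavy_nb y| = 3 /\ weak_deg y <= 1} -> False.
Proof.
move=> xa xb ab hx HY; have [c cP H] := triple_reduction xa xb ab hx.
have ox := card_heavy_nb_mid xa xb ab; have oa := card_heavy_nb_end xa xb hx.
have ba : b != a by rewrite eq_sym.
have ob := card_heavy_nb_end xb xa hx.
have YC : [set b; x; a] = [set a; x; b].
  by apply/setP => y; rewrite !inE -!orbA orbC -orbA orbCA.
rewrite YC adjC in ob.
set Y := [set a; x; b] in ox oa ob c cP H HY.
have aY : a \in Y by rewrite !inE eqxx.
have xY : x \in Y by rewrite !inE eqxx orbT.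
have bY : b \in Y by rewrite !inE eqxx !orbT.
have [sa wa] := HY a aY; have [sx wx] := HY x xY; have [sb wb] := HY b bY.
have Wx : #|weak_link Y x| <= 1 := leq_trans (weak_link_le xY) wx.
have Wa : #|weak_link Y a| <= 1 := leq_trans (weak_link_le aY) wa.
have Wb : #|weak_link Y b| <= 1 := leq_trans (weak_link_le bY) wb.
have [|C EC] := strong_colors1 c (Y := Y) (x := x); first by move: ox sx; card_lia.
(* In the triangle [a] is coloured first; then [x], among at least 4 - 1 colours of which at most
   two block [b]; then [b]. *)
have [adj_ab|nadj_ab] := boolP (adj a b).
  rewrite adj_ab in oa ob.
  have [|D ED] := strong_colors1 c (Y := Y) (x := a); first by move: oa sa; card_lia.
  have [|E EE] := strong_colors1 c (Y := Y) (x := b); first by move: ob sb; card_lia.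
  have [z Ez] := colors_weak1 c Wb; rewrite EE in Ez.
  (* These are antipodal to [E] as seen from [b], and to [C] as seen from [x]. *)
  pose w1 := sgn (sg a b) (antipode E); pose w2 := sgn (sg x a) (antipode C).
  have /card_gt0P[A] : 0 < #|colors Y c a :\ w1 :\ w2|.
    have := leq_card_colors Y c a; rewrite ED card_nbh.
    have := leq_card_setD1 (colors Y c a) w1.
    by have := leq_card_setD1 (colors Y c a :\ w1) w2; move: Wa; card_lia.
  rewrite !in_setD1 => /and3P[Aw2 Aw1 AL].
  pose Q := sgn (sg x a) A.
  (* The product of the three edge signs, [==] being multiplication of signs. *)
  pose t := (sg x b == sg a b) == sg x a.
  have tQ : sgn t Q = sgn (sg x b) (sgn (sg a b) A).
    by rewrite /Q /t !sgn_sgn; case: (sg x b) (sg a b) (sg x a) => [] [] [].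
  have EQ : sgn (sg x b) E != antipode (sgn t Q).
    rewrite tQ -sgn_antipode (can_eq (sgnK _)) -sgn_antipode.
    by apply: contraNneq Aw1 => E'; rewrite /w1 E' sgn_antipode /antipode !sgnK.
  have CQ : C != antipode Q.
    apply: contraNneq Aw2 => E'.
    by rewrite /w2 E' /Q -!sgn_antipode sgnK /antipode sgnK.
  have far := card_far_nbh2_in (sgn (sg x b) z) EQ.
  set F := [set _ in _ | _] in far.
  have /card_gt0P[X] : 0 < #|(colors Y c x :&: nbh Q) :\: F|.
    have := card_nbh2 CQ; have := leq_card_colorsI Y c x (nbh Q); rewrite EC cardsD.
    have := subset_leq_card (subsetIr (colors Y c x :&: nbh Q) F).
    by move: Wx far; card_lia.
  rewrite in_setD in_setI => /and3P[XF XL XQ].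
  move: XF; rewrite inE XQ andTb => /set0Pn[B'].
  rewrite in_setI in_setD1 in_setI => /and4P[XB Bz BQ BE].
  apply: (H A X (sgn (sg x b) B')) => //.
  - apply: (subsetP Ez); rewrite in_setD1 mem_nbh_sgn BE andbT.
    by apply: contraNneq Bz => <-; rewrite sgnK.
  - by move: XQ; rewrite inE pos_adj_sym.
  - by move: XB; rewrite inE sgnK.
  - by rewrite !pos_adj_sgn; move: BQ; rewrite tQ inE.
  - by rewrite adj_ab.
rewrite (negbTE nadj_ab) in oa ob.
have [|D [E [DE EDE]]] := strong_colors2 cP (x := a); first by move: oa sa; card_lia.
have [|D' [E' [DE' EDE']]] := strong_colors2 cP (x := b); first by move: ob sb; card_lia.
have sDE t : sgn t D != antipode (sgn t E) by rewrite -sgn_antipode (can_eq (sgnK _)).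
have sDE' t : sgn t D' != antipode (sgn t E').
  by rewrite -sgn_antipode (can_eq (sgnK _)).
have Lx : 8 <= #|colors Y c x|.
  by have := leq_card_colors Y c x; rewrite EC card_nbh; move: Wx; card_lia.
have [lab|nlab] := boolP (linked a b).
  have lba : linked b a.
    by case/existsP: lab => u /and3P[lu au bu]; apply/existsP; exists u; rewrite lu au bu.
  (* The only possible link goes through the common light neighbour and ends in [Y], so nothing is
     forbidden at the ends. *)
  have full y z : y \in Y -> z \in Y -> y != z -> linked y z -> weak_deg y <= 1 ->
      colors Y c y = strong_colors Y c y.
    move=> yY zY yz /(weak_link_lt yY zY yz) W w1.
    have: weak_link Y y = set0 by apply: cards0_eq; move: W w1; card_lia.
    by rewrite /colors => ->; rewrite imset0 setD0.
  have La := full a b aY bY ab lab wa; have Lb := full b a bY aY ba lba wb.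
  have n1 := card_near1 C (sDE (sg x a)); have n0 := card_near0 (sDE' (sg x b)).
  set N1 := [set _ in _ | _] in n1; set N0 := [set _ | _] in n0.
  (* At least 8 colours, minus 5 that leave [a] fewer than two choices, minus 2 that leave [b]
     none. *)
  have /card_gt0P[X] : 0 < #|colors Y c x :\: N1 :\: N0|.
    rewrite (cardsD _ N0) (cardsD _ N1).
    have := subset_leq_card (subsetIr (colors Y c x) N1).
    have := subset_leq_card (subsetIr (colors Y c x :\: N1) N0).
    by move: n1 n0 Lx; card_lia.
  case/setDP=> /setDP[XL XN1] XN0.
  have XC : X \in nbh C by rewrite -EC; apply: (subsetP (colors_sub Y c x)).
  move: XN0; rewrite inE => /set0Pn[B]; rewrite !in_setI => /and3P[XB BD BE].
  move: XN1; rewrite inE XC andTb -ltnNge => /card_gt1P[A1 [A2 []]].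
  rewrite !in_setI => /and3P[XA1 A1D A1E] /and3P[XA2 A2D A2E] A12.
  have [A [XA AD AE] AB] : exists2 A, [/\ A \in nbh X, A \in nbh (sgn (sg x a) D)
      & A \in nbh (sgn (sg x a) E)] & A.2 != B.2.
    have [E1|] := eqVneq A1.2 B.2; last by exists A1.
    by exists A2 => //; rewrite -E1 eq_sym; apply: nbh_pt XA1 XA2 A12.
  apply: (H (sgn (sg x a) A) X (sgn (sg x b) B)) => //.
  - by rewrite La EDE in_setI !mem_nbh_sgn AD.
  - by rewrite Lb EDE' in_setI !mem_nbh_sgn BD.
  - by rewrite sgnK; move: XA; rewrite inE.
  - by rewrite sgnK; move: XB; rewrite inE.
  - by rewrite (negbTE nadj_ab).
have [z Ez] := colors_weak1 c Wa; have [z' Ez'] := colors_weak1 c Wb.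
have f := card_far_nbh2 (sgn (sg x a) z) (sDE (sg x a)).
have f' := card_far_nbh2 (sgn (sg x b) z') (sDE' (sg x b)).
set F := [set _ | _] in f; set F' := [set _ | _] in f'.
(* Here at least 8 - 3 - 3 colours remain. *)
have /card_gt0P[X] : 0 < #|colors Y c x :\: F :\: F'|.
  rewrite (cardsD _ F') (cardsD _ F).
  have := subset_leq_card (subsetIr (colors Y c x) F).
  have := subset_leq_card (subsetIr (colors Y c x :\: F) F').
  by move: f f' Lx; card_lia.
case/setDP=> /setDP[XL XF] XF'; move: XF'; rewrite inE => /set0Pn[B].
rewrite in_setI in_setD1 in_setI => /and4P[XB Bz BD BE].
move: XF; rewrite inE => /set0Pn[A].
rewrite in_setI in_setD1 in_setI => /and4P[XA Az AD AE].
apply: (H (sgn (sg x a) A) X (sgn (sg x b) B)) => //.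
- apply: (subsetP Ez); rewrite EDE in_setD1 in_setI !mem_nbh_sgn AD AE !andbT.
  by apply: contraNneq Az => <-; rewrite sgnK.
- apply: (subsetP Ez'); rewrite EDE' in_setD1 in_setI !mem_nbh_sgn BD BE !andbT.
  by apply: contraNneq Bz => <-; rewrite sgnK.
- by rewrite sgnK; move: XA; rewrite inE.
- by rewrite sgnK; move: XB; rewrite inE.
- by rewrite (negbTE nadj_ab).
- by rewrite (negbTE nlab).
Qed.

(** All heavy neighbours of [x] are uncoloured with it, so [x] keeps at least 20 - 4 = 16 colours,
    while each end keeps at least two. *)
Lemma path323_excluded a x b : a \in heavy_nb x -> b \in heavy_nb x ->
  a != b -> ~~ light x -> #|heavy_nb x| = 2 -> weak_deg x <= 4 ->
  {in [set a; b], forall y, #|heavy_nb y| = 3 /\ weak_deg y <= 2} -> False.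
Proof.
move=> xa xb ab hx sx wx HY; have [c cP H] := triple_reduction xa xb ab hx.
have ox := card_heavy_nb_mid xa xb ab; have oa := card_heavy_nb_end xa xb hx.
have ob := card_heavy_nb_end xb xa hx.
have YC : [set b; x; a] = [set a; x; b].
  by apply/setP => y; rewrite !inE -!orbA orbC -orbA orbCA.
rewrite YC adjC in ob.
set Y := [set a; x; b] in ox oa ob c cP H.
have aY : a \in Y by rewrite !inE eqxx.
have xY : x \in Y by rewrite !inE eqxx orbT.
have bY : b \in Y by rewrite !inE eqxx !orbT.
have [sa wa] := HY a (set21 a b); have [sb wb] := HY b (set22 a b).
have Wx : #|weak_link Y x| <= 4 := leq_trans (weak_link_le xY) wx.
have Wa : #|weak_link Y a| <= 2 := leq_trans (weak_link_le aY) wa.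
have Wb : #|weak_link Y b| <= 2 := leq_trans (weak_link_le bY) wb.
have Sx : #|strong_colors Y c x| = 20.
  by apply: strong_colors0; move: ox sx; card_lia.
have SxT : strong_colors Y c x = setT.
  by apply/eqP; rewrite eqEcard subsetT cardsT Sx card_tromp.
have Lx : 16 <= #|colors Y c x|.
  by have := leq_card_colors Y c x; rewrite Sx; move: Wx; card_lia.
(* Among the nine neighbours of [A] as seen from [x], at least 9 - 4 = 5 are in the list of [x] and
   six are adjacent to [B1] or [B2] as seen from [x]. *)
have finish A B1 B2 : A \in colors Y c a -> B1 \in colors Y c b ->
    B2 \in colors Y c b -> B1.2 != B2.2 -> A.2 != B1.2 -> A.2 != B2.2 ->
    (adj a b -> pos_adj A (sgn (sg a b) B1) && pos_adj A (sgn (sg a b) B2)) -> False.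
  move=> AL B1L B2L B12 AB1 AB2 adjAB.
  have nQ B : A.2 != B.2 -> sgn (sg x b) B != antipode (sgn (sg x a) A).
    by apply: contraNneq => E; have /= -> := congr1 snd E.
  have pt : (sgn (sg x b) B1).2 != (sgn (sg x b) B2).2 by [].
  have G := card_nbhI_nbhU pt (nQ _ AB1) (nQ _ AB2).
  have LQ := leq_card_colorsI Y c x (nbh (sgn (sg x a) A)).
  rewrite SxT setTI card_nbh in LQ.
  have [|X] := subset_meet (subsetIr (colors Y c x) (nbh (sgn (sg x a) A)))
    (subsetIl _ (nbh (sgn (sg x b) B1) :|: nbh (sgn (sg x b) B2))).
    by rewrite card_nbh; move: Wx G LQ; card_lia.
  case/setIP=> /setIP[XL XA] /setIP[_ /setUP XB].
  rewrite inE pos_adj_sym in XA.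
  case: XB; rewrite inE pos_adj_sym => XB.
    by apply: (H A X B1) => // /adjAB/andP[].
  by apply: (H A X B2) => // /adjAB/andP[].
have [adj_ab|nadj_ab] := boolP (adj a b).
  rewrite adj_ab in oa ob.
  have [|D ED] := strong_colors1 c (Y := Y) (x := a); first by move: oa sa; card_lia.
  have [|E EE] := strong_colors1 c (Y := Y) (x := b); first by move: ob sb; card_lia.
  pose w := sgn (sg a b) (antipode E).
  have /card_gt0P[A] : 0 < #|colors Y c a :\ w|.
    have := leq_card_colors Y c a; rewrite ED card_nbh.
    by have := leq_card_setD1 (colors Y c a) w; move: Wa; card_lia.
  rewrite in_setD1 => /andP[Aw AL].
  have EA : E != antipode (sgn (sg a b) A).
    apply: contraNneq Aw => E'.
    by rewrite /w E' -!sgn_antipode sgnK /antipode sgnK.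
  have /card_gt1P[B1 [B2 []]] : 1 < #|colors Y c b :&: nbh (sgn (sg a b) A)|.
    have := leq_card_colorsI Y c b (nbh (sgn (sg a b) A)); rewrite EE.
    by have := card_nbh2 EA; move: Wb; card_lia.
  move=> /setIP[B1L B1A] /setIP[B2L B2A] B12.
  apply: (finish A B1 B2 AL B1L B2L).
  - exact: nbh_pt B1A B2A B12.
  - by move: B1A; rewrite inE => /pos_adj_pt.
  - by move: B2A; rewrite inE => /pos_adj_pt.
  - by rewrite !pos_adj_sgn; move: B1A B2A; rewrite !inE => -> ->.
rewrite (negbTE nadj_ab) in oa ob.
have [|D [E [DE EDE]]] := strong_colors2 cP (x := a); first by move: oa sa; card_lia.
have [|D' [E' [DE' EDE']]] := strong_colors2 cP (x := b); first by move: ob sb; card_lia.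
have La := leq_card_colors Y c a; rewrite EDE in La.
have Lb := leq_card_colors Y c b; rewrite EDE' in Lb.
have La4 := card_nbh2 DE; have Lb4 := card_nbh2 DE'.
have inD A : A \in colors Y c a -> A \in nbh D.
  by move/(subsetP (colors_sub Y c a)); rewrite EDE => /setIP[].
have inD' B : B \in colors Y c b -> B \in nbh D'.
  by move/(subsetP (colors_sub Y c b)); rewrite EDE' => /setIP[].
have [lab|nlab] := boolP (linked a b).
  have lba : linked b a.
    by case/existsP: lab => u /and3P[lu au bu]; apply/existsP; exists u; rewrite lu au bu.
  have ba : b != a by rewrite eq_sym.
  (* Each end loses a link, which leaves at least 4 - 1 colours; at [b] at most one of them has the
     point of [A]. *)
  have la := weak_link_lt aY bY ab lab; have lb := weak_link_lt bY aY ba lba.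
  have /card_gt0P[A AL] : 0 < #|colors Y c a|.
    by move: La La4 la wa; card_lia.
  have /card_gt1P[B1 [B2 []]] : 1 < #|[set B in colors Y c b | A.2 != B.2]|.
    have : #|colors Y c b :\: [set B | A.2 != B.2]| <= 1.
      rewrite leqNgt; apply/negP => /card_gt1P[B1 [B2 []]].
      move=> /setDP[B1L]; rewrite inE negbK => /eqP E1.
      move=> /setDP[B2L]; rewrite inE negbK => /eqP E2 B12.
      by have := nbh_pt (inD' _ B1L) (inD' _ B2L) B12; rewrite -E1 E2 eqxx.
    have := cardsID [set B | A.2 != B.2] (colors Y c b).
    have -> : colors Y c b :&: [set B | A.2 != B.2] =
      [set B in colors Y c b | A.2 != B.2].
      by apply/setP=> B; rewrite in_setI [RHS]inE [X in _ && X]inE.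
    by move: Lb Lb4 lb wb; card_lia.
  rewrite inE => /andP[B1L AB1]; rewrite inE => /andP[B2L AB2] B12.
  apply: (finish A B1 B2) => //; last by rewrite (negbTE nadj_ab).
  exact: nbh_pt (inD' _ B1L) (inD' _ B2L) B12.
have /card_gt1P[A1 [A2 [A1L A2L A12]]] : 1 < #|colors Y c a|.
  by move: La La4 Wa; card_lia.
have /card_gt1P[B1 [B2 [B1L B2L B12]]] : 1 < #|colors Y c b|.
  by move: Lb Lb4 Wb; card_lia.
have Apt : (sgn (sg x a) A1).2 != (sgn (sg x a) A2).2.
  exact: nbh_pt (inD _ A1L) (inD _ A2L) A12.
have Bpt : (sgn (sg x b) B1).2 != (sgn (sg x b) B2).2.
  exact: nbh_pt (inD' _ B1L) (inD' _ B2L) B12.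
(* Each end reaches at least 14 of the 20 colours, so both reach at least 8 in common, and the list
   of [x] misses at most 4. *)
have UA := card_nbhU Apt; have UB := card_nbhU Bpt.
set NA := _ :|: _ in UA; set NB := _ :|: _ in UB.
have T20 : #|[set: tromp]| = 20 by rewrite cardsT card_tromp.
have [|X] := subset_meet (subsetT (colors Y c x)) (subsetT (NA :&: NB)).
  have := cardsUI NA NB; have := subset_leq_card (subsetT (NA :|: NB)).
  by rewrite T20; move: UA UB Lx; card_lia.
case/setIP=> XL /setIP[XA XB].
have [A AL XA'] : exists2 A, A \in colors Y c a & pos_adj X (sgn (sg x a) A).
  by case/setUP: XA; rewrite inE pos_adj_sym => ?; [exists A1|exists A2].
have [B BL XB'] : exists2 B, B \in colors Y c b & pos_adj X (sgn (sg x b) B).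
  by case/setUP: XB; rewrite inE pos_adj_sym => ?; [exists B1|exists B2].
by apply: (H A X B) => //; rewrite ?(negbTE nadj_ab) ?(negbTE nlab).
Qed.

(** * Discharging *)

Definition deg_nb k x : nat := #|[set u in nb x | #|nb u| == k]|.

Lemma heavy_nbE x u : (u \in heavy_nb x) = adj x u && ~~ light u.
Proof. by rewrite !inE. Qed.

Lemma sum_light_nb (F : nat -> nat) x :
  \sum_(u in nb x | light u) F #|nb u| = deg_nb 2 x * F 2 + deg_nb 3 x * F 3.
Proof.
rewrite (bigID (fun u => #|nb u| == 2)) /=; congr (_ + _).
  rewrite (eq_bigr (fun=> F 2)) => [|u /andP[_ /eqP->]//].
  rewrite sum_nat_cond_const; congr (_ * _); apply: eq_card => u.
  by rewrite !inE /light; case: eqP => [->|]; rewrite ?andbT ?andbF.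
rewrite (eq_bigr (fun=> F 3)) => [|u].
  rewrite sum_nat_cond_const; congr (_ * _); apply: eq_card => u.
  rewrite !inE /light; case xu: (adj x u) => //=.
  have := deg_ge2 (x := u) (y := x); rewrite adjC xu => /(_ isT).
  by case: #|nb u| => [|[|[|[|]]]].
rewrite inE /light => /andP[/andP[xu u3] /eqP u2]; congr F; apply/eqP.
have := deg_ge2 (x := u) (y := x); rewrite adjC xu => /(_ isT).
by move: u2 u3; move: #|nb u| => n; lia.
Qed.

Lemma deg_split x : #|nb x| = #|heavy_nb x| + (deg_nb 2 x + deg_nb 3 x).
Proof.
rewrite -[deg_nb 2 x]muln1 -[deg_nb 3 x]muln1 -(sum_light_nb (fun=> 1)).
rewrite -sum1_card (bigID light) /= addnC; congr (_ + _).
by rewrite -sum1_card; apply: eq_bigl => u; rewrite heavy_nbE inE.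
Qed.

(** A light neighbour of degree d contributes one pair for each of its d - 1 neighbours other than
    [x]. *)
Lemma weak_degE x : weak_deg x = deg_nb 2 x + deg_nb 3 x * 2.
Proof.
rewrite -[deg_nb 2 x]muln1 -(sum_light_nb predn) /weak_deg -sum1_card.
rewrite (eq_bigl (fun p => ((p.1 \in nb x) && light p.1) && (p.2 \in nb p.1 :\ x))).
  rewrite -(pair_big_dep (fun u => (u \in nb x) && light u)
    (fun u z => z \in nb u :\ x) (fun _ _ => 1)) /=.
  apply: eq_bigr => u /andP[]; rewrite inE => xu _.
  by rewrite sum1_card (cardsD1 x (nb u)) inE adjC xu.
by move=> p; rewrite !inE -!andbA; do 2!congr (_ && _); rewrite andbC.
Qed.

Lemma heavy_light_nb x : ~~ light x -> #|heavy_nb x| <= 3 ->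
  exists2 u, adj x u & light u.
Proof.
rewrite /light -ltnNge => x4 s3.
have /card_gt0P[u] : 0 < #|nb x :\: heavy_nb x|.
  by have := cardsID (heavy_nb x) (nb x);
     have := subset_leq_card (subsetIr (nb x) (heavy_nb x)); move: x4 s3; card_lia.
rewrite in_setD heavy_nbE inE => /andP[+ xu]; rewrite xu negbK => lu.
by exists u.
Qed.

(** At a heavy vertex the bounds on [weak_deg] are attained: degree at least 4 leaves a light
    neighbour in the first case, and [weak_deg_min] gives 4 in the second. *)
Definition deficient x : bool :=
  (#|heavy_nb x| == 3) && (weak_deg x <= 1) ||
  [&& #|heavy_nb x| == 2, weak_deg x <= 4 & deg_nb 3 x == 0].

(** The amount for each deficient neighbour. The value 2 splits the surplus 30 * 5 - 102 - 2 * 21 =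
    6 over three heavy neighbours. *)
Definition share x : nat :=
  if (#|heavy_nb x| == 2) && (weak_deg x <= 5) then 0
  else if (#|heavy_nb x| == 3) && (weak_deg x <= 1) then 0
  else if [&& #|heavy_nb x| == 3, deg_nb 2 x == 2 & deg_nb 3 x == 0] then 2
  else 4.

Definition flow x u : nat :=
  if adj x u && ~~ light x then
    if #|nb u| == 2 then 21 else if #|nb u| == 3 then 4
    else if deficient u then share x else 0
  else 0.

Lemma sum_nb (F : V -> nat) x :
  (forall u, ~~ adj x u -> F u = 0) ->
  \sum_u F u = \sum_(u in nb x | light u) F u + \sum_(u in heavy_nb x) F u.
Proof.
move=> F0; rewrite (bigID (mem (nb x))) /= addnC big1 ?add0n => [|u]; last first.
  by rewrite inE; apply: F0.
rewrite (bigID light) /=; congr (_ + _).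
by apply: eq_bigl => u; rewrite heavy_nbE inE.
Qed.

Lemma flow_out x : ~~ light x -> \sum_u flow x u <=
  deg_nb 2 x * 21 + deg_nb 3 x * 4 + #|heavy_nb x| * share x.
Proof.
move=> hx; pose F n := if n == 2 then 21 else if n == 3 then 4 else 0.
rewrite (sum_nb (x := x)) => [|u /negbTE xu]; last by rewrite /flow xu.
apply: leq_add.
  rewrite -(sum_light_nb F) leq_eqVlt; apply/orP; left; apply/eqP.
  apply: eq_bigr => u; rewrite inE => /andP[xu u3]; rewrite /flow xu hx /F.
  have := deg_ge2 (x := u) (y := x); rewrite adjC xu => /(_ isT).
  by move: u3; rewrite /light; case: #|nb u| => [|[|[|[|]]]].
rewrite -sum_nat_const; apply: leq_sum => u; rewrite heavy_nbE /light => /andP[xu u4].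
rewrite /flow xu hx; move: u4; case: #|nb u| => [|[|[|[|n]]]] //= _.
by case: ifP.
Qed.

Lemma flow_out_light x : light x -> \sum_u flow x u = 0.
Proof. by move=> lx; apply: big1 => u _; rewrite /flow lx andbF. Qed.

Lemma flow_in_deficient x : ~~ light x -> deficient x ->
  \sum_u flow u x = \sum_(u in heavy_nb x) share u.
Proof.
move=> hx dx; rewrite (sum_nb (x := x)) => [|u /negbTE xu]; last first.
  by rewrite /flow adjC xu.
rewrite big1 ?add0n => [|u /andP[_ lu]]; last by rewrite /flow lu andbF.
apply: eq_bigr => u; rewrite heavy_nbE => /andP[xu hu].
rewrite /flow adjC xu hu dx; move: hx; rewrite /light.
by case: #|nb x| => [|[|[|[|]]]].
Qed.

Lemma share_ge2 u : ~~ ((#|heavy_nb u| == 2) && (weak_deg u <= 5)) ->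
  ~~ ((#|heavy_nb u| == 3) && (weak_deg u <= 1)) -> 2 <= share u.
Proof. by move=> /negbTE E1 /negbTE E2; rewrite /share E1 E2; case: ifP. Qed.

Lemma share_ge4 u : ~~ ((#|heavy_nb u| == 2) && (weak_deg u <= 5)) ->
  ~~ ((#|heavy_nb u| == 3) && (weak_deg u <= 2)) -> 4 <= share u.
Proof.
move=> /negbTE E1 /nandP E2; rewrite /share E1 weak_degE.
case: E2 => [/negbTE->//|]; rewrite weak_degE -ltnNge => w3.
case: ifP => [/andP[_]|_]; first by move: w3; lia.
by case: ifP => // /and3P[_ /eqP E2 /eqP E3]; move: w3; rewrite E2 E3.
Qed.

Lemma share_deficient x : deficient x -> share x = 0.
Proof.
rewrite /share; case/orP => [/andP[-> ->]|/and3P[-> w4 _]]; first by rewrite if_same.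
by rewrite (leq_trans w4).
Qed.

(** No neighbour has type (2, at most 5), by [pair_excluded], and at most one has type (3, at most
    1), by [path333_excluded]; the other two give at least 2 each. *)
Lemma flow_in_deficient3 x : ~~ light x -> #|heavy_nb x| = 3 -> weak_deg x <= 1 ->
  4 <= \sum_u flow u x.
Proof.
move=> hx sx wx; rewrite flow_in_deficient ?/deficient ?sx ?wx //.
set B := [set u in heavy_nb x | (#|heavy_nb u| == 3) && (weak_deg u <= 1)].
have B1 : #|B| <= 1.
  rewrite leqNgt; apply/negP => /card_gt1P[a [b [+ + ab]]].
  rewrite !inE -!heavy_nbE => /and3P[xa /eqP sa wa] /and3P[xb /eqP sb wb].
  by apply: (path333_excluded xa xb ab hx) => y /set3P[]->.
have BC : 2 <= #|heavy_nb x :\: B|.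
  have := cardsD (heavy_nb x) B; have := subset_leq_card (subsetIr (heavy_nb x) B).
  by move: B1 sx; card_lia.
rewrite (big_setID B) /=; apply: leq_trans (leq_addl _ _).
apply: leq_trans (_ : 2 * #|heavy_nb x :\: B| <= _).
  by rewrite -[4]/(2 * 2) leq_mul2l BC.
rewrite mulnC -sum_nat_const; apply: leq_sum => u /setDP[xu uB].
apply: share_ge2; last by move: uB; rewrite inE xu.
apply/negP=> /andP[/eqP su wu]; have hu : ~~ light u by move: xu; rewrite heavy_nbE => /andP[].
by apply: (pair_excluded hu (heavy_nbC hx xu) su wu); right.
Qed.

(** By [pair_excluded] both neighbours give at least 2, and by [path323_excluded] one of them gives
    4. *)
Lemma flow_in_deficient2 x : ~~ light x -> #|heavy_nb x| = 2 -> weak_deg x <= 4 ->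
  deg_nb 3 x = 0 -> 6 <= \sum_u flow u x.
Proof.
move=> hx sx wx n3; rewrite flow_in_deficient ?/deficient ?sx ?wx ?n3 //.
have /eqP/cards2P[a [b [ab E]]] := sx.
have xa : a \in heavy_nb x by rewrite E set21.
have xb : b \in heavy_nb x by rewrite E set22.
have wx5 : weak_deg x <= 5 by apply: leq_trans wx _.
have no u : u \in heavy_nb x -> ~~ ((#|heavy_nb u| == 2) && (weak_deg u <= 5)) /\
    ~~ ((#|heavy_nb u| == 3) && (weak_deg u <= 1)).
  move=> xu; split; apply/negP=> /andP[/eqP su wu];
    by apply: (pair_excluded hx xu sx wx5); auto.
have [a2 a3] := no a xa; have [b2 b3] := no b xb.
rewrite E big_setU1 ?inE // big_set1.
have sha := share_ge2 a2 a3; have shb := share_ge2 b2 b3.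
have [/andP[/eqP sa wa]|na] := boolP ((#|heavy_nb a| == 3) && (weak_deg a <= 2)); last first.
  by rewrite -[6]/(4 + 2) leq_add // share_ge4.
have [/andP[/eqP sb wb]|nb] := boolP ((#|heavy_nb b| == 3) && (weak_deg b <= 2)); last first.
  by rewrite -[6]/(2 + 4) leq_add // share_ge4.
by case: (path323_excluded xa xb ab hx sx wx) => y /set2P[]->.
Qed.

Lemma flow_in_light x k : light x -> 0 < #|nb x| ->
  k = (if #|nb x| == 2 then 21 else 4) -> \sum_u flow u x = #|nb x| * k.
Proof.
move=> lx /card_gt0P[v]; rewrite inE => xv kE.
rewrite (bigID (mem (nb x))) /= addnC big1 ?add0n => [|u]; last first.
  by rewrite inE => /negbTE xu; rewrite /flow adjC xu.
rewrite -sum_nat_const; apply: eq_bigr => u; rewrite inE => xu.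
rewrite /flow adjC xu (light_indep xu lx) kE; have := deg_ge2 xv; move: lx; rewrite /light.
by case: #|nb x| => [|[|[|[|]]]].
Qed.

(** The final charge is nonnegative, written without subtraction. Light vertices balance exactly: 60
    + 42 = 90 + 12 = 102. *)
Lemma local_balance x : 0 < #|nb x| ->
  102 + \sum_u flow x u <= 30 * #|nb x| + \sum_u flow u x.
Proof.
move=> x0; have /card_gt0P[v] := x0; rewrite inE => xv.
have [lx|hx] := boolP (light x).
  rewrite flow_out_light // (flow_in_light lx x0 erefl).
  have := deg_ge2 xv; move: lx; rewrite /light.
  by case: #|nb x| => [|[|[|[|]]]].
have out := flow_out hx; have dx := deg_split x; have wE := weak_degE x.
have x4 : 4 <= #|nb x| by move: hx; rewrite /light -ltnNge.
have [Dx|nDx] := boolP (deficient x).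
  rewrite (share_deficient Dx) muln0 addn0 in out.
  have /orP[/andP[/eqP sx wx]|/and3P[/eqP sx wx /eqP n3]] := Dx.
    have := flow_in_deficient3 hx sx wx.
    by move: out dx wE x4 sx wx; card_lia.
  have := flow_in_deficient2 hx sx wx n3.
  have [|u xu lu] := heavy_light_nb hx; first by rewrite sx.
  have [_ _ /(_ sx)] := weak_deg_min hx xu lu.
  by move: out dx wE x4 sx wx n3; card_lia.
have out' : 102 + (deg_nb 2 x * 21 + deg_nb 3 x * 4 + #|heavy_nb x| * share x) <=
    30 * #|nb x|; last by move: out out'; card_lia.
(* Each heavy neighbour leaves at least 26 of its 30, and 4 * 26 = 104. *)
rewrite dx; have [s4|s3] := leqP 4 #|heavy_nb x|.
  have : #|heavy_nb x| * share x <= #|heavy_nb x| * 4.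
    by rewrite leq_mul2l; apply/orP; right; rewrite /share; do !case: ifP.
  by move: s4; card_lia.
(* A light neighbour leaves 9 or 26 of its 30, so large [weak_deg] pays the rest; one heavy
   neighbour gives at least 26 + 9 * 9 = 107. *)
have [u xu lu] := heavy_light_nb hx s3.
have [w0 w1 w2] := weak_deg_min hx xu lu.
move: s3 nDx w0 w1 w2 dx x4 out; rewrite /share /deficient wE.
case: #|heavy_nb x| => [|[|[|[|//]]]] _ nDx w0 w1 w2 dx x4 out /=.
- by have := w0 erefl; card_lia.
- by have := w1 erefl; card_lia.
- have := w2 erefl; move: nDx => /=; clear.
  by case: ifP => /=; move: (deg_nb 2 x) (deg_nb 3 x) => m n; lia.
- move: nDx => /=; clear; case: ifP => //= w1 _; move: w1.
  move: (deg_nb 2 x) (deg_nb 3 x) => m n.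
  by case: ifP => [/andP[/eqP-> /eqP->]//|]; lia.
Qed.

(** Summing [local_balance] cancels the flow. Edge-minimality does not exclude isolated vertices, so
    the sum runs over the others. *)
Lemma dense_support : exists2 S : {set V}, S != set0 &
  17 * #|S| <= 5 * \sum_(x in S) #|[set y in S | adj x y]|.
Proof.
pose S := [set x | 0 < #|nb x|]; exists S.
  apply/eqP => S0; apply: (not_col (c := fun=> (true, None))) => x y xy.
  have : x \in S by rewrite inE; apply/card_gt0P; exists y; rewrite inE.
  by rewrite S0 inE.
have E x : x \in S -> #|[set y in S | adj x y]| = #|nb x|.
  move=> _; apply: eq_card => y; rewrite !inE andb_idl // => xy.
  by apply/card_gt0P; exists x; rewrite inE adjC.
rewrite (eq_bigr _ E) {E}.
have flow0 x : x \notin S -> (forall u, flow x u = 0) /\ (forall u, flow u x = 0).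
  rewrite inE -eqn0Ngt cards_eq0 => /eqP x0.
  have nx u : adj x u = false by have := in_set0 u; rewrite -x0 inE.
  by split=> u; rewrite /flow ?nx // adjC nx.
have tot : \sum_(x in S) \sum_u flow x u = \sum_(x in S) \sum_u flow u x.
  transitivity (\sum_x \sum_u flow x u).
    rewrite [RHS](bigID (mem S)) /= [X in _ = _ + X]big1 ?addn0 // => x.
    by move=> /flow0[f _]; apply: big1.
  rewrite exchange_big [LHS](bigID (mem S)) /= [X in _ + X = _]big1 ?addn0 // => x.
  by move=> /flow0[_ f]; apply: big1.
have : \sum_(x in S) (102 + \sum_u flow x u) <=
    \sum_(x in S) (30 * #|nb x| + \sum_u flow u x).
  by apply: leq_sum => x; rewrite inE => /local_balance.
rewrite big_split [X in _ <= X]big_split /= -tot leq_add2r sum_nat_const.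
have -> : \sum_(x in S) 30 * #|nb x| = 30 * \sum_(x in S) #|nb x|.
  by rewrite big_distrr.
move: (\sum_(x in S) _); card_lia.
Qed.

End Minimal.

(** * From bounded average degree to the homomorphism *)

Definition sparse (V : finType) (adj : rel V) : Prop := forall S : {set V},
  S != set0 -> 5 * \sum_(x in S) #|[set y in S | adj x y]| < 17 * #|S|.

(** Induction on the number of arcs: sparsity passes to subgraphs, so a failure would be a minimal
    counterexample, which [dense_support] refutes. *)
Lemma sparse_proper_col (V : finType) (adj : rel V) (sg : V -> V -> bool) :
  symmetric adj -> irreflexive adj ->
  (forall x y, adj x y -> sg x y = sg y x) -> sparse adj ->
  exists c, proper_col sg adj c.
Proof.
have [n] := ubnP (\sum_x #|[set y | adj x y]|).
elim: n adj => // n IH adj ltn adjC adjI sgC spA.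
pose b := [exists c : {ffun V -> tromp}, forall x, forall y,
  adj x y ==> pos_adj (c x) (sgn (sg x y) (c y))].
have [/existsP[c /forallP cP]|/existsPn nb0] := boolP b.
  by exists c => x y xy; have /forallP/(_ y)/implyP := cP x; apply.
have not_col c : ~ proper_col sg adj c.
  move=> cP; have /negP := nb0 [ffun x => c x]; apply.
  by apply/forallP => x; apply/forallP => y; apply/implyP; rewrite !ffunE; apply: cP.
have [] // := dense_support adjC adjI sgC not_col.
  move=> adj' symA subA [x [y /andP[xy nxy]]]; apply: IH => //.
  - rewrite ltnS in ltn; apply: leq_trans ltn.
    rewrite (bigD1 x) //= [X in _ < X](bigD1 x) //= -addSn.
    apply: leq_add; last first.
      apply: leq_sum => z _; apply: subset_leq_card; apply/subsetP => u.
      by rewrite !inE; apply: subA.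
    apply: proper_card; apply/properP; split; last by exists y; rewrite inE.
    by apply/subsetP => u; rewrite !inE; apply: subA.
  - by move=> z; apply/negbTE/negP => /subA; rewrite adjI.
  - by move=> z u /subA; apply: sgC.
  - move=> S S0; apply: leq_ltn_trans (spA S S0); rewrite leq_mul2l /=.
    apply: leq_sum => z _; apply: subset_leq_card; apply/subsetP => u.
    by rewrite !inE => /andP[-> /subA].
by move=> S S0; rewrite leqNgt spA.
Qed.

(** An edge is the image of at most two arcs, [p] and its reverse. *)
Lemma card_arcs_le (V : finType) (adj : rel V) (S : {set V}) :
  \sum_(x in S) #|[set y in S | adj x y]| <=
  2 * #|[set e in edges adj | e \subset S]|.
Proof.
set F := [set e in _ | _].
pose D := [set p : V * V | [&& p.1 \in S, p.2 \in S & adj p.1 p.2]].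
have -> : \sum_(x in S) #|[set y in S | adj x y]| = #|D|.
  rewrite -[RHS]sum1_card (eq_bigl (fun p => (p.1 \in S) &&
    (p.2 \in [set y in S | adj p.1 y]))) => [|p]; last by rewrite !inE.
  rewrite -(pair_big_dep (mem S) (fun x y => y \in [set y in S | adj x y])
    (fun _ _ => 1)) /=.
  by apply: eq_bigr => x _; rewrite sum1_card.
pose h (p : V * V) := [set p.1; p.2].
have hF p : p \in D -> h p \in F.
  rewrite !inE => /and3P[p1 p2 pa]; apply/andP; split.
    by apply/imset2P; exists p.1 p.2; rewrite ?inE.
  by apply/subsetP => z /set2P[]->.
rewrite -sum1_card (partition_big h (mem F)) //= mulnC -sum_nat_const.
apply: leq_sum => e _; rewrite sum1dep_card.
have [->|/set0Pn[p]] := eqVneq [set x in D | h x == e] set0; first by rewrite cards0.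
rewrite inE => /andP[_ /eqP pe].
suff: [set x in D | h x == e] \subset [set p; (p.2, p.1)].
  by move/subset_leq_card => H; apply: leq_trans H _; rewrite cards2; case: (_ != _).
apply/subsetP => q; rewrite inE => /andP[qD /eqP qe].
have q12 : q.1 \in h p /\ q.2 \in h p by rewrite pe -qe !inE !eqxx orbT.
have p12 : p.1 \in h q /\ p.2 \in h q by rewrite qe -pe !inE !eqxx orbT.
case: p q12 p12 {pe qe qD} => p1 p2; case: q => q1 q2 [/set2P/= A /set2P/= B].
move=> [/set2P/= C /set2P/= E]; rewrite !inE !xpair_eqE.
by case: A => ?; case: B => ?; case: C => ?; case: E => ?; subst;
  rewrite ?eqxx ?orbT.
Qed.

Lemma mad_lt_sparse (V : finType) (adj : rel V) :
  mad_lt adj (17%:R / 5%:R)%R -> sparse adj.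
Proof.
move=> mad S S0.
have := mad S [set e in edges adj | e \subset S] S0.
have sub : [set e in edges adj | e \subset S] \subset edges adj.
  by apply/subsetP => e; rewrite inE => /andP[].
move=> /(_ sub); have sS e : e \in [set e in edges adj | e \subset S] -> e \subset S.
  by rewrite inE => /andP[].
move=> /(_ sS); have Sp : (0 < #|S|%:R :> rat)%R by rewrite Num.Theory.ltr0n card_gt0.
rewrite Num.Theory.ltr_pdivrMr // GRing.mulrAC Num.Theory.ltr_pdivlMr //.
rewrite -!GRing.natrM Num.Theory.ltr_nat => H.
have := card_arcs_le adj S.
by move: (\sum_(x in S) _) H; card_lia.
Qed.

(** Without repetitions each vertex is switched at most once, so only membership matters. *)
Lemma switch_seqE (V : eqType) (s : seq V) (sg : V -> V -> bool) x y : uniq s ->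
  switch_seq s sg x y = (x \in s) (+) (y \in s) (+) sg x y.
Proof.
elim: s => //= z s IH /andP[zs us]; rewrite /switch IH // !inE !addbA; congr (_ (+) _).
have [->|xz] := eqVneq x z; have [->|yz] := eqVneq y z;
  rewrite ?(negbTE zs) //=; by case: (_ \in s) => //; case: (_ \in s).
Qed.

Theorem theorem3 (V : finType) (adj : rel V) (sg : V -> V -> bool) :
  symmetric adj -> irreflexive adj ->
  (forall x y, adj x y -> sg x y = sg y x) ->
  mad_lt adj (17%:R / 5%:R)%R ->
  exists phi : V -> option F9, signed_hom adj sg SP9p_adj SP9p_sign phi.
Proof.
move=> adjC adjI sgC /mad_lt_sparse sp.
have [c cP] := sparse_proper_col adjC adjI sgC sp.
(* The point of a colour is the image, and its layer decides whether the vertex is switched. *)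
exists (fun x => (c x).2), (enum [set x | (c x).1]) => x y xy.
have := cP x y xy; rewrite /pos_adj => /andP[pt sn]; split=> //.
rewrite switch_seqE ?enum_uniq // !mem_enum !inE.
move: sn; rewrite /=.
by case: (c x).1 (c y).1 (sg x y) (SP9p_sign _ _) => [] [] [] [].
Qed.
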